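(* Let $g_1$ and $g_2$ be graphs such that $g_1\le g_2$, i.e. $g_1$ is a subgraph of $g_2$. Then $g_1\xrightarrow{A\bot} g_2$, i.e. $g_1$ equi-implies $g_2$ by the $A\bot$-criterion.
   Context: Boolean formulae. Fix a countable set of variables. A literal is a variable $x$, its negation $\overline{x}$, or a constant $\top$, $\bot$. A clause is a disjunction of one or more literals, viewed as a set of literals. A Cnf is a conjunction of one or more clauses, viewed as a set of clauses. An assignment is a set of literals not containing both a literal and its negation. For a Cnf $x$ and assignment $a$, $x[a]$ is the Cnf obtained by replacing, for each $l\in a$, every occurrence of $l$ in $x$ by $\top$ and every occurrence of $\overline{l}$ by $\bot$, simplified by the usual rules for $\top,\bot$. Graphs. Each vertex $v$ is also a boolean variable. An edge is a nonempty set of vertices; a graph is a nonempty multiset of edges, written $(e_1)^{n_1}\cdots(e_m)^{n_m}$ with $n_i$ the multiplicity of $e_i$. The edge $v_1\cdots v_k$ supports the $2^k$ clauses $l_1\vee\cdots\vee l_k$ with $l_i\in\{v_i,\overline{v_i}\}$. The edge $e$ with multiplicity $n$ corresponds to the set of all Cnfs $c_1\wedge\cdots\wedge c_n$ with $c_1,\dots,c_n$ pairwise distinct clauses supported on $e$. A graph $(e_1)^{n_1}\cdots(e_m)^{n_m}$ is identified with the set of all Cnfs $x_1\wedge\cdots\wedge x_m$ with $x_i$ in the set corresponding to $e_i$ with multiplicity $n_i$. A graph $g$ is a subgraph of a graph $h$, $g\le h$, if every edge of $g$ (counting duplicates as distinct) is also an edge of $h$. For sets of Cnfs $s_1,s_2$,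 we say $s_1$ equi-implies $s_2$ by the $A\bot$-criterion, written here $s_1\xrightarrow{A\bot}s_2$, if for every Cnf $x_1\in s_1$ there exists a Cnf $x_2\in s_2$ such that for every assignment $a$, $x_1[a]=\bot$ implies $x_2[a]=\bot$.
   Formalization: It is assumed that every edge of g_2 with k vertices has multiplicity at most 2^k; otherwise g_2 corresponds to the empty set of Cnfs and the claim fails, e.g. for g_1 = v and g_2 = v w^3. *)

(* Defs.v *)
From HB Require Import structures.
From mathcomp Require Import all_boot.
From mathcomp Require Import finmap multiset.
From mathcomp Require Import boolp classical_sets.

Set Implicit Arguments.
Unset Strict Implicit.
Unset Printing Implicit Defensive.

Local Open Scope fset_scope.
Local Open Scope mset_scope.

Section Literals.
Variable V : countType.

Inductive literal := Pos of V | Neg of V | Top | Bot.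

Definition literal_code (l : literal) : (V + V) + bool :=
  match l with
  | Pos v => inl (inl v)
  | Neg v => inl (inr v)
  | Top => inr true
  | Bot => inr false
  end.

Definition literal_decode (s : (V + V) + bool) : literal :=
  match s with
  | inl (inl v) => Pos v
  | inl (inr v) => Neg v
  | inr true => Top
  | inr false => Bot
  end.

Lemma literal_codeK : cancel literal_code literal_decode.
Proof. by case. Qed.

HB.instance Definition _ := Countable.copy literal (can_type literal_codeK).

Definition neg (l : literal) : literal :=
  match l with
  | Pos v => Neg v
  | Neg v => Pos v
  | Top => Bot
  | Bot => Top
  end.

End Literals.

Arguments Top {V}.
Arguments Bot {V}.

Definition clause (V : countType) := {c : {fset literal V} | c != fset0}.

Definition cnf (V : countType) := {x : {fset clause V} | x != fset0}.

Section Substitution.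
Variable V : countType.

Lemma fset1_neq0 (K : choiceType) (k : K) : [fset k] != fset0.
Proof. by apply/fset0Pn; exists k; rewrite inE. Qed.

Lemma imfset_neq0 (K K' : choiceType) (f : K -> K') (A : {fset K}) :
  A != fset0 -> [fset f k | k in A] != fset0.
Proof.
by case/fset0Pn=> k kA; apply/fset0Pn; exists (f k); rewrite in_imfset.
Qed.

(* The truth values, as one-literal clauses and as one-clause Cnfs. *)
Definition clause_top : clause V := exist _ [fset Top] (fset1_neq0 Top).
Definition clause_bot : clause V := exist _ [fset Bot] (fset1_neq0 Bot).
Definition cnf_top : cnf V := exist _ [fset clause_top] (fset1_neq0 clause_top).
Definition cnf_bot : cnf V := exist _ [fset clause_bot] (fset1_neq0 clause_bot).

(* An assignment may be infinite. *)
Definition is_assignment (a : set (literal V)) : Prop :=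
  forall l, ~ (a l /\ a (neg l)).

Definition lit_subst (a : set (literal V)) (l : literal V) : literal V :=
  if l \in a then Top else if neg l \in a then Bot else l.

Definition clause_subst (a : set (literal V)) (c : clause V) : clause V :=
  exist _ [fset lit_subst a l | l in val c] (imfset_neq0 _ (valP c)).

Definition cnf_subst (a : set (literal V)) (x : cnf V) : cnf V :=
  exist _ [fset clause_subst a c | c in val x] (imfset_neq0 _ (valP x)).

(* T \/ c = T and _|_ \/ c = c; [insubd] returns _|_ when no literal is left. *)
Definition clause_simp (c : clause V) : clause V :=
  if Top \in val c then clause_top else insubd clause_bot (val c `\ Bot)%fset.

(* After simplifying the clauses, _|_ /\ x = _|_ and T /\ x = x; [insubd]
   returns T when no clause is left. *)
Definition cnf_simp (x : cnf V) : cnf V :=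
  let cs := [fset clause_simp c | c in val x] in
  if clause_bot \in cs then cnf_bot else insubd cnf_top (cs `\ clause_top)%fset.

Definition cnf_assign (x : cnf V) (a : set (literal V)) : cnf V :=
  cnf_simp (cnf_subst a x).

Definition equi_implies_Abot (s1 s2 : set (cnf V)) : Prop :=
  forall x1, s1 x1 -> exists2 x2, s2 x2 &
    forall a, is_assignment a ->
      cnf_assign x1 a = cnf_bot -> cnf_assign x2 a = cnf_bot.

End Substitution.

Definition edge (V : countType) := {e : {fset V} | e != fset0}.

Definition graph (V : countType) := {g : {mset edge V} | g != mset0}.

Section Graphs.
Variable V : countType.

Definition multiplicity (g : graph V) (e : edge V) : nat := val g e.

Definition subgraph (g h : graph V) : bool := (val g `<=` val h)%mset.

Definition supports (e : edge V) (c : clause V) : Prop :=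
  exists s : V -> bool,
    val c = [fset (if s v then Pos v else Neg v) | v in val e].

(* Cnfs being sets of clauses, a conjunction of n pairwise distinct clauses is
   a Cnf with exactly n elements. *)
Definition edge_cnfs (e : edge V) (n : nat) : set (cnf V) :=
  [set x | #|` val x| = n /\ forall c, c \in val x -> supports e c].

(* The values of the family [y] outside the edges of [g] are irrelevant. *)
Definition graph_cnfs (g : graph V) : set (cnf V) :=
  [set x | exists2 y : edge V -> cnf V,
     forall e, e \in val g -> edge_cnfs e (multiplicity g e) (y e) &
     val x = \bigcup_(e <- finsupp (val g)) val (y e)].

(* An edge with k vertices supports only 2 ^ k clauses; with a larger
   multiplicity it corresponds to the empty set of Cnfs. *)
Definition admissible (g : graph V) : Prop :=
  forall e, (multiplicity g e <= 2 ^ #|` val e|)%N.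

End Graphs.

(* Main.v *)
Require Import Defs.
From mathcomp Require Import all_boot.
From mathcomp Require Import finmap multiset.
From mathcomp Require Import boolp classical_sets.

(** Adding clauses to a Cnf can only make it easier to falsify: after an
    assignment, a Cnf collapses to _|_ exactly when one of its clauses does
    ([cnf_assign_botP]), and this clause survives in every larger Cnf
    ([cnf_assign_bot_sub]).  So it suffices to embed every Cnf of [g1], as a set
    of clauses, in a Cnf of [g2].  This is done one edge at a time: on each edge,
    the clauses chosen for [g1] are completed to the number of clauses that [g2]
    prescribes.  There is room for this because an edge with k vertices supports
    2 ^ k clauses ([card_edge_clauses]) and the multiplicities of [g2] do not
    exceed that number ([supported_clauses_extend]).  The union of the completed
    choices over the edges of [g2] contains the given Cnf, since every edge of
    [g1] is an edge of [g2]. *)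

Set Implicit Arguments.
Unset Strict Implicit.
Unset Printing Implicit Defensive.

Local Open Scope fset_scope.

Lemma fset_extend_card (K : choiceType) (A B : {fset K}) (n : nat) :
  A `<=` B -> (#|` A| <= n)%N -> (n <= #|` B|)%N ->
  exists D : {fset K}, [/\ A `<=` D, D `<=` B & #|` D| = n].
Proof.
move=> sAB; elim: n => [|n IHn]; first rewrite leqn0 => A0 _.
  by exists A; split=> //; apply/eqP.
rewrite leq_eqVlt => /orP[/eqP cA _|ltAn ltnB]; first by exists A.
have [D [sAD sDB cD]] := IHn ltAn (ltnW ltnB).
have /fset0Pn[x] : B `\` D != fset0.
  by rewrite fsetD_eq0; apply: contraL ltnB => /fsubset_leq_card; rewrite cD -leqNgt.
rewrite inE => /andP[xD xB]; exists (x |` D); split.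
- exact: fsubset_trans sAD (fsubsetU1 _ _).
- by rewrite fsubUset fsub1set xB.
- by rewrite cardfsU1 xD cD.
Qed.

Section ClausesOfAnEdge.
Variables (V : countType) (e : edge V).

Definition signed_clause (A : {fset V}) : clause V :=
  exist _ [fset (if v \in A then Pos v else Neg v) | v in val e]
    (imfset_neq0 _ (valP e)).

Definition edge_clauses : {fset clause V} :=
  [fset signed_clause A | A in fpowerset (val e)].

Lemma edge_clauses_supported c : c \in edge_clauses -> supports e c.
Proof. by case/imfsetP=> A _ ->; exists (fun v => v \in A). Qed.

Lemma supported_edge_clauses c : supports e c -> c \in edge_clauses.
Proof.
case=> s cE; apply/imfsetP; exists [fset v in val e | s v] => /=.
  by rewrite fpowersetE; apply/fsubsetP=> v; rewrite !inE => /andP[].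
apply: val_inj; rewrite cE /=.
by apply: eq_in_imfset => v //= ve; rewrite !inE ve.
Qed.

Lemma Pos_signed_clause (A : {fset V}) v :
  A `<=` val e -> (Pos v \in val (signed_clause A)) = (v \in A).
Proof.
move=> /fsubsetP sAe; apply/imfsetP/idP => [[w _]|vA].
  by case: ifP => // wA [->].
by exists v; rewrite ?vA //= sAe.
Qed.

(** A supported clause is determined by its set of positive variables, which may
    be any subset of the edge. *)
Lemma card_edge_clauses : #|` edge_clauses| = (2 ^ #|` val e|)%N.
Proof.
rewrite -card_fpowerset; apply: card_in_imfset => A B /=.
rewrite !fpowersetE => sA sB eqAB.
by apply/fsetP=> v; rewrite -(Pos_signed_clause v sA) eqAB Pos_signed_clause.
Qed.

Lemma supported_clauses_extend (C : {fset clause V}) n :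
  (forall c, c \in C -> supports e c) ->
  (#|` C| <= n <= 2 ^ #|` val e|)%N ->
  exists D : {fset clause V},
    [/\ C `<=` D, #|` D| = n & forall c, c \in D -> supports e c].
Proof.
move=> supC /andP[leCn]; rewrite -card_edge_clauses => len.
have sC : C `<=` edge_clauses.
  by apply/fsubsetP=> c /supC /supported_edge_clauses.
have [D [sCD /fsubsetP sD cD]] := fset_extend_card sC leCn len.
by exists D; split=> // c /sD /edge_clauses_supported.
Qed.

End ClausesOfAnEdge.

Section Falsification.
Variable V : countType.

Lemma clause_top_neq_bot : clause_top V != clause_bot V.
Proof.
apply/eqP=> /(congr1 val) /fsetP /(_ Top).
by rewrite !inE eqxx.
Qed.

(** Simplification of clauses can produce _|_, but that of the conjunction cannot:
    removing T from a set of clauses without _|_ leaves no _|_, and the empty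
    conjunction is read as T. *)
Lemma cnf_assign_botP (x : cnf V) (a : set (literal V)) :
  cnf_assign x a = cnf_bot V <->
  exists2 c, c \in val x & clause_simp (clause_subst a c) = clause_bot V.
Proof.
rewrite /cnf_assign /cnf_simp /=; set cs := imfset _ _ _.
have csP : reflect
    (exists2 c, c \in val x & clause_simp (clause_subst a c) = clause_bot V)
    (clause_bot V \in cs).
  rewrite /cs; apply: (iffP (imfsetP _ _ _ _)) => [[_ /imfsetP[c cx ->] ->]|[c cx <-]]; first by exists c.
  by exists (clause_subst a c) => //; apply/imfsetP; exists c.
case: ifP => [/csP //|/negP bot_cs].
split=> [simp_bot|/csP //]; case: bot_cs.
have: clause_bot V \in val (cnf_bot V) by rewrite inE.
rewrite -simp_bot val_insubd; case: ifP => _; first by rewrite inE => /andP[].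
by rewrite inE eq_sym (negPf clause_top_neq_bot).
Qed.

Lemma cnf_assign_bot_sub (x y : cnf V) (a : set (literal V)) :
  val x `<=` val y -> cnf_assign x a = cnf_bot V -> cnf_assign y a = cnf_bot V.
Proof.
move=> /fsubsetP sxy /cnf_assign_botP[c /sxy cy c_bot].
by apply/cnf_assign_botP; exists c.
Qed.

End Falsification.

Section Subgraphs.
Variable V : countType.

(** An edge of [g2] that is not in [g1] constrains nothing, so the extension
    starts there from the empty set of clauses. *)
Lemma edge_cnfs_extend (g1 g2 : graph V) (e : edge V) (y1 : edge V -> cnf V) :
  admissible g2 -> subgraph g1 g2 ->
  (forall e', e' \in val g1 -> edge_cnfs e' (multiplicity g1 e') (y1 e')) ->
  e \in val g2 ->
  exists2 z, edge_cnfs e (multiplicity g2 e) z &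
    e \in val g1 -> val (y1 e) `<=` val z.
Proof.
move=> adm /msubsetP sg y1P eg2.
pose C := if e \in val g1 then val (y1 e) else fset0.
have supC c : c \in C -> supports e c.
  by rewrite /C; case: ifP => // eg1; have [_] := y1P e eg1; apply.
have leC : (#|` C| <= multiplicity g2 e)%N.
  rewrite /C; case: ifP => [eg1|_]; last by rewrite cardfs0.
  by have [-> _] := y1P e eg1; apply: sg.
have CP : (#|` C| <= multiplicity g2 e <= 2 ^ #|` val e|)%N by rewrite leC adm.
have [D [sCD cD supD]] := supported_clauses_extend supC CP.
have D0 : D != fset0.
  by rewrite -cardfs_gt0 cD /multiplicity mset_gt0.
exists (exist _ D D0) => //= eg1.
by move: sCD; rewrite /C eg1.
Qed.

Lemma graph_cnfs_extend (g1 g2 : graph V) (x1 : cnf V) :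
  admissible g2 -> subgraph g1 g2 -> graph_cnfs g1 x1 ->
  exists2 x2, graph_cnfs g2 x2 & val x1 `<=` val x2.
Proof.
move=> adm sg [y1 y1P x1E].
have /choice[y2 y2P] : forall e, exists z, e \in val g2 ->
    edge_cnfs e (multiplicity g2 e) z /\ (e \in val g1 -> val (y1 e) `<=` val z).
  move=> e; case: (boolP (e \in val g2)) => [eg2|_]; last by exists x1.
  by have [z zP sz] := edge_cnfs_extend adm sg y1P eg2; exists z.
pose X := \bigcup_(e <- finsupp (val g2)) val (y2 e).
have sX : val x1 `<=` X.
  rewrite x1E; apply/bigfcupsP => e + _; rewrite msuppE => eg1.
  have eg2 : e \in val g2 by apply: (msubset_subset sg).
  apply: (@fsubset_trans _ (val (y2 e))); last by apply: bigfcup_sup; rewrite ?msuppE.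
  by have [_] := y2P e eg2; apply.
have X0 : X != fset0.
  apply: contraNneq (valP x1) => X0.
  by move: sX; rewrite X0 fsubset0.
exists (exist _ X X0) => //; exists y2 => // e eg2.
by have [] := y2P e eg2.
Qed.

End Subgraphs.

Theorem lemma3p2 (V : countType) (g1 g2 : graph V)
  (g2_admissible : admissible g2) (g1_le_g2 : subgraph g1 g2) :
  equi_implies_Abot (graph_cnfs g1) (graph_cnfs g2).
Proof.
move=> x1 /(graph_cnfs_extend g2_admissible g1_le_g2)[x2 gx2 sx].
by exists x2 => // a _; apply: cnf_assign_bot_sub.
Qed.
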